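(* Let $k \geq 6$ be an integer. Then there exists a threshold $N = N(k)$ such that if $G$ is a finite group of order larger than $N$, then for every real number $c > 0$ and every set $S \subseteq G \times G$ with $|S| \geq c|G|^2$, there exists a set $K \subseteq G$ of $k$ elements which spans at least $\frac{c}{2^{10}}k^2$ triples $(a,b,ab)$ from $S$, i.e. there are at least $\frac{c}{2^{10}}k^2$ pairs $(a,b) \in S$ with $a, b, ab \in K$.
   Context: For a group $G$, a set $S \subseteq G \times G$ and a subset $K \subseteq G$, a triple $(a,b,ab) \in G^3$ is said to be a triple from $S$ if $(a,b) \in S$, and it is spanned by $K$ if $a \in K$, $b \in K$ and $ab \in K$. *)

(* Defs.v *)
From HB Require Import structures.
From mathcomp Require Import all_boot all_order all_fingroup all_algebra.
From mathcomp Require Import reals.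

Set Implicit Arguments.
Unset Strict Implicit.
Unset Printing Implicit Defensive.

(* A triple (a, b, ab) from S is determined by the pair (a, b) \in S, so the
   triples from S spanned by K are represented by these pairs. *)
Definition spanned_triples (gT : finGroupType) (S : {set gT * gT})
    (K : {set gT}) : {set gT * gT} :=
  [set p in S | [&& p.1 \in K, p.2 \in K & (p.1 * p.2)%g \in K]].

(* Main.v *)
Require Import Defs.
From HB Require Import structures.
From mathcomp Require Import all_boot all_order all_fingroup all_algebra.
From mathcomp Require Import cyclic pgroup sylow.
From mathcomp Require Import reals.

Set Implicit Arguments.
Unset Strict Implicit.
Unset Printing Implicit Defensive.

Import Order.TTheory GRing.Theory Num.Theory.
Local Open Scope ring_scope.

(** If [A] is a subset of [G] with [|AA| <= 2|A|], then for [x], [y] in [G] the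
    set [xA \cup Ay \cup xAAy] has at most [4|A|] elements and contains [a], [b]
    and [ab] for all [(a, b)] in [xA * Ay]; averaging over [x] and [y], some
    such rectangle contains at least [c|A|^2] elements of [S]. It remains to
    find [A] with [k/8 <= |A| <= k/4]. If every Sylow subgroup of [G] had order
    at most [n], then [|G|] would divide [n!]; so a large [G] has a [p]-subgroup
    [P] of order larger than [n := k %/ 4]. Choose [H] normal in [P] with
    [|H| <= n < p|H|] and [z] of order [p] in [P / H]: then [A] is the preimage
    of the progression [{1, z, ..., z^(m-1)}], where [m := n %/ |H|]. *)

Lemma exists_large_p_part (n g : nat) :
  (n`! < g)%N -> exists2 p, prime p & (n < g`_p)%N.
Proof.
move=> lt_ng; have g_gt0: (0 < g)%N by apply: leq_ltn_trans lt_ng.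
have: ~~ (g %| n`!)%N.
  by apply: contraL lt_ng => /dvdn_leq; rewrite fact_gt0 -leqNgt; apply.
have [/hasP[p pi_p lt_np] _|/hasPn small] :=
  boolP (has (fun p : nat => n < g`_p)%N (primes g)).
  by exists p => //; move: pi_p; rewrite mem_primes; case/and3P.
case/negP; apply/dvdn_partP => // p pi_p.
by rewrite dvdn_fact // part_gt0 leqNgt small.
Qed.

Section SmallDoubling.

Local Open Scope group_scope.

(** The fibre of [coset H] over each element of [C] is a right coset of [H]. *)
Lemma card_cosetpre_set (gT : finGroupType) (H : {group gT})
    (C : {set coset_of H}) :
  #|coset H @*^-1 C| = (#|H| * #|C|)%N.
Proof.
rewrite -sum1_card (partition_big (coset H) [in C]) /=; last first.
  by move=> x /morphpreP[].
rewrite mulnC -sum_nat_const; apply: eq_bigr => y Cy.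
have [x Nx def_y] := cosetP y.
rewrite sum1_card -(card_rcoset H x) -cosetpre_set1 // -def_y.
apply: eq_card => u; rewrite [LHS]unfold_in /= !inE -andbA.
congr (_ && _) => /=.
by case: (coset H u =P y) => [->|_]; rewrite ?andbF // Cy.
Qed.

Definition progression (gT : finGroupType) (z : gT) (m : nat) : {set gT} :=
  [set z ^+ (i : 'I_m) | i : 'I_m].

(** Powers may repeat here; this is applied at length [m.*2], which can exceed the order of [z]. *)
Lemma card_progression_le (gT : finGroupType) (z : gT) (m : nat) :
  (#|progression z m| <= m)%N.
Proof. by rewrite (leq_trans (leq_imset_card _ _)) ?card_ord. Qed.

Lemma card_progression (gT : finGroupType) (z : gT) (m : nat) :
  (m <= #[z])%N -> #|progression z m| = m.
Proof.
move=> le_m; rewrite card_imset ?card_ord // => i j /eqP.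
by rewrite eq_expg_ord // => /eqP.
Qed.

Lemma progression_mul_sub (gT : finGroupType) (z : gT) (m : nat) :
  progression z m * progression z m \subset progression z m.*2.
Proof.
apply/subsetP=> _ /mulsgP[_ _ /imsetP[i _ ->] /imsetP[j _ ->] ->].
have lt_ij: (i + j < m.*2)%N.
  by rewrite -addnn -addSn leq_add // ltnW.
by rewrite -expgD; apply/imsetP; exists (Ordinal lt_ij).
Qed.

Lemma exists_coset_prime_order (gT : finGroupType) (n p : nat) :
    (0 < n)%N -> prime p -> (n < #|gT|`_p)%N ->
  exists (H : {group gT}) (z : coset_of H),
    (#|H| <= n)%N /\ (n < #|H| * #[z])%N.
Proof.
move=> n_gt0 p_pr lt_n; have p_gt1 := prime_gt1 p_pr.
have [P sylP] := Sylow_exists p [set: gT].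
have pP := pHall_pgroup sylP.
have oP: #|P| = (p ^ logn p #|gT|)%N.
  by rewrite (card_Hall sylP) p_part cardsT.
have /andP[le_e lt_e] := trunc_log_bounds p_gt1 n_gt0.
(* [p ^ e] is the largest power of [p] not exceeding [n], and will be the order of [H]. As
   [e < logn p #|gT|], the quotient [P / H] is nontrivial and Cauchy's theorem applies. *)
set e := trunc_log p n in le_e lt_e.
have lt_e_log: (e < logn p #|gT|)%N.
  rewrite -(ltn_exp2l _ _ p_gt1) -p_part.
  exact: leq_ltn_trans le_e lt_n.
have [|H [sHP nHP oH]] := normal_pgroup (r := e) pP (normal_refl P).
  by rewrite oP pfactorK // ltnW.
have dvd_p: (p %| #|P / H|)%N.
  rewrite card_quotient ?normal_norm // -divgS // oP oH -expnB ?prime_gt0 //.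
    by rewrite dvdn_exp // subn_gt0.
  exact: ltnW.
have [z _ oz] := Cauchy p_pr dvd_p.
by exists H, z; rewrite oz oH -expnSr.
Qed.

Lemma exists_small_doubling (gT : finGroupType) (n : nat) :
    (0 < n)%N -> (n`! < #|gT|)%N ->
  exists A : {set gT},
    [/\ (#|A| <= n)%N, (n < 2 * #|A|)%N & (#|A * A|%g <= 2 * #|A|)%N].
Proof.
move=> n_gt0 /exists_large_p_part[p p_pr lt_n].
have [H [z [le_Hn lt_nHz]]] := exists_coset_prime_order n_gt0 p_pr lt_n.
have H_gt0 := cardG_gt0 H.
set m := (n %/ #|H|)%N.
have m_gt0: (0 < m)%N by rewrite divn_gt0.
have le_m: (m <= #[z])%N by rewrite ltnW // ltn_divLR // mulnC.
exists (coset H @*^-1 progression z m).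
rewrite -cosetpreM !card_cosetpre_set card_progression //; split.
- by rewrite mulnC leq_divM.
(* [n < (m + 1) * #|H| <= 2 * m * #|H|], the last step because [m >= 1]. *)
- rewrite mulnCA mul2n mulnC; apply: leq_trans (_ : m.+1 * #|H| <= _)%N.
    exact: ltn_ceil.
  by rewrite leq_mul2r -addnn -addn1 leq_add2l m_gt0 orbT.
rewrite mulnCA leq_mul2l mul2n; apply/orP; right.
apply: leq_trans (card_progression_le z m.*2).
exact/subset_leq_card/progression_mul_sub.
Qed.

(** Double counting: [s] lies in the rectangle of [q] exactly when [q.1] is in [s.1 *: A^-1] and
    [q.2] is in [A^-1 :* s.2], which leaves [#|A| ^ 2] choices of [q]. *)
Lemma sum_card_translates (gT : finGroupType) (S : {set gT * gT})
    (A : {set gT}) :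
  (\sum_(q : gT * gT) #|S :&: setX (q.1 *: A) (A :* q.2)|
    = #|S| * #|A| ^ 2)%N.
Proof.
under eq_bigr do rewrite -sum1_card.
rewrite (exchange_big_dep [in S]) /=; last by move=> q s _ /setIP[].
rewrite -sum_nat_const; apply: eq_bigr => s Ss; rewrite sum1_card.
have <-: #|setX (s.1 *: A^-1) (A^-1 :* s.2)| = (#|A| ^ 2)%N.
  by rewrite cardsX card_lcoset card_rcoset card_invg.
apply: eq_card => q; rewrite [LHS]unfold_in /= [LHS]inE Ss /= !inE.
by rewrite !mem_lcoset !mem_rcoset !mem_invg !invMg !invgK.
Qed.

Lemma exists_dense_translate (gT : finGroupType) (S : {set gT * gT})
    (A : {set gT}) :
  exists x y : gT,
    (#|S| * #|A| ^ 2 <= #|gT| ^ 2 * #|S :&: setX (x *: A) (A :* y)|)%N.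
Proof.
pose F (q : gT * gT) := #|S :&: setX (q.1 *: A) (A :* q.2)|.
case: (@arg_maxnP _ (1, 1) xpredT F isT) => -[x y] _ max_xy.
exists x, y; rewrite -sum_card_translates -[(#|gT| ^ 2)%N]card_prod.
by rewrite -sum_nat_const; apply: leq_sum => q _; apply: max_xy.
Qed.

Lemma exists_superset_card (T : finType) (A : {set T}) (k : nat) :
  (#|A| <= k <= #|T|)%N -> exists2 B : {set T}, A \subset B & #|B| = k.
Proof.
case/andP=> le_Ak le_kT.
have: (k - #|A| <= #|~: A|)%N by rewrite leq_subLR cardsC.
case/card_geqP=> s [uniq_s size_s sub_s].
exists (A :|: [set x in s]); first exact: subsetUl.
have disj: [disjoint A & [set x in s]].
  rewrite disjoint_sym disjoints_subset; apply/subsetP=> x.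
  by rewrite inE => /sub_s.
by rewrite cardsU disjoint_setI0 // cards0 subn0 cardsE (card_uniqP uniq_s)
           size_s subnKC.
Qed.

Lemma card_translates_le (gT : finGroupType) (A : {set gT}) (x y : gT) :
  (#|(x *: A) :|: (A :* y) :|: (x *: (A * A) :* y)|%g <= 2 * #|A| + #|A * A|%g)%N.
Proof.
rewrite mul2n -addnn (leq_trans (leq_card_setU _ _)) //.
rewrite card_rcoset card_lcoset leq_add2r (leq_trans (leq_card_setU _ _)) //.
by rewrite card_rcoset card_lcoset.
Qed.

Lemma spanned_translates (gT : finGroupType) (S : {set gT * gT})
    (A K : {set gT}) (x y : gT) :
    (x *: A) :|: (A :* y) :|: (x *: (A * A) :* y) \subset K ->
  S :&: setX (x *: A) (A :* y) \subset spanned_triples S K.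
Proof.
rewrite !subUset => /andP[/andP[sxA sAy] sxAy].
apply/subsetP=> -[a b]; rewrite !inE /= => /and3P[-> Aa Ab] /=.
rewrite (subsetP sxA) // (subsetP sAy) //= (subsetP sxAy) //.
(* [x^-1 * (a * b) * y^-1] regroups as [(x^-1 * a) * (b * y^-1)], a product of two elements of
   [A]. *)
rewrite mem_rcoset mem_lcoset !mulgA -mulgA mem_mulg //.
  by rewrite -mem_lcoset.
by rewrite -mem_rcoset.
Qed.

End SmallDoubling.

Theorem theorem1p2 (k : nat) (hk : (6 <= k)%N) :
  exists N : nat, forall gT : finGroupType, (N < #|gT|)%N ->
    forall (R : realType) (c : R) (S : {set gT * gT}),
      0 < c -> c * #|gT|%:R ^+ 2 <= #|S|%:R ->
      exists K : {set gT},
        #|K| = k /\ c / 2 ^+ 10 * k%:R ^+ 2 <= #|spanned_triples S K|%:R.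
Proof.
exists k`! => gT lt_k R c S c_gt0 dense_S.
have n_gt0: (0 < k %/ 4)%N by rewrite divn_gt0 // (leq_trans _ hk).
have [|A [le_A gt_A dbl_A]] := @exists_small_doubling gT _ n_gt0.
  by rewrite (leq_ltn_trans _ lt_k) // leq_fact // leq_div.
have [x [y dense_xy]] := exists_dense_translate S A.
have le_kT: (k <= #|gT|)%N by rewrite ltnW // (leq_ltn_trans (fact_geq k)).
have [|K subK cardK] :=
  @exists_superset_card gT ((x *: A) :|: (A :* y) :|: (x *: (A * A) :* y))%g k.
  rewrite le_kT andbT (leq_trans (card_translates_le A x y)) //.
  apply: leq_trans (leq_divM k 4).
  apply: leq_trans (_ : #|A| * 4 <= _)%N; last by rewrite leq_mul2r le_A.
  by rewrite [leqRHS](_ : _ = 2 * #|A| + 2 * #|A|)%N ?leq_add2l //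
             -mulnDl mulnC.
exists K; split=> //.
(* [k < 4 * (k %/ 4 + 1) <= 4 * (2 * #|A|)]. *)
have le_kA: (k <= 8 * #|A|)%N.
  rewrite -[8%N]/(4 * 2)%N -mulnA ltnW // (leq_trans (ltn_ceil k (d := 4) _)) //.
  by rewrite mulnC leq_mul2l.
have gT_gt0: 0 < #|gT|%:R ^+ 2 :> R.
  by rewrite exprn_gt0 // ltr0n (leq_ltn_trans _ lt_k).
apply: le_trans (_ : #|S :&: setX (x *: A) (A :* y)|%g%:R <= _); last first.
  by rewrite ler_nat subset_leq_card // spanned_translates.
(* After scaling by [#|gT| ^ 2], density of [S] and the choice of [x], [y] leave only
   [k ^ 2 <= 2 ^ 10 * #|A| ^ 2], which holds since [k ^ 2 <= 64 * #|A| ^ 2]. *)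
rewrite -(ler_pM2l gT_gt0).
apply: le_trans (_ : #|S|%:R * #|A|%:R ^+ 2 <= _); last first.
  by rewrite -!natrX -!natrM ler_nat.
apply: le_trans (_ : c * #|gT|%:R ^+ 2 * #|A|%:R ^+ 2 <= _); last first.
  by rewrite ler_wpM2r // exprn_ge0.
rewrite [leRHS]mulrAC [leRHS]mulrC ler_pM2l // -mulrA ler_pM2l // mulrC.
rewrite ler_pdivrMr ?exprn_gt0 // -!natrX -natrM ler_nat.
apply: leq_trans (_ : (8 * #|A|) ^ 2 <= _)%N; first by rewrite leq_sqr.
by rewrite expnMn mulnC leq_mul2l orbC.
Qed.
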